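(* Let $\langle R,\sim\rangle$ be the Rado graph, $L\in\mathbb P(R)$, and let $\langle\{L_n:n\in\omega\},\{q^{\bigcup_{i<n}L_i}_K:n\in\omega,K\subset\bigcup_{i<n}L_i\}\rangle$ be a labeling of $L$. Define $\le_L$ on $L$ by $q^{\bigcup_{i<m}L_i}_{K'}\le_L q^{\bigcup_{i<n}L_i}_{K''}$ iff $L^{\bigcup_{i<m}L_i}_{K'}\subset L^{\bigcup_{i<n}L_i}_{K''}$. Then for each $n\in\omega$ and $K\subset\bigcup_{i<n}L_i$, in the poset $\langle L,\le_L\rangle$: (a) $(q^{\bigcup_{i<n}L_i}_K,q^\emptyset_\emptyset]=\{q^{\bigcup_{i<m}L_i}_{K\cap\bigcup_{i<m}L_i}:m<n\}$; (b) $\langle L,\le_L\rangle$ is a reversed tree with the top $q^\emptyset_\emptyset$ and the set $L_n$ is its $n$-th level; (c) $(-\infty,q^{\bigcup_{i<n}L_i}_K]=L^{\bigcup_{i<n}L_i}_K$; (d) the set of immediate predecessors of $q^{\bigcup_{i<n}L_i}_K$ in $\langle L,\le_L\rangle$ equals $\{q^{\bigcup_{i<n+1}L_i}_{K\cup K_1}:K_1\subset L_n\}$; (e) $\langle L,\le_L\rangle$ is a finitely branching reversed tree without minimal nodes; in fact each element of $L_n$ has $2^{|L_n|}=2^{m_n}$ immediate predecessors.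
   Context: The Rado graph $\langle R,\sim\rangle$ is the unique countable graph such that $R^H_K\neq\emptyset$ for all finite $K\subset H\subset R$, where $R^H_K=\{v\in R\setminus H:\forall k\in K\,(v\sim k)\wedge\forall h\in H\setminus K\,(v\not\sim h)\}$; for $L\subset R$, $L^H_K=L\cap R^H_K$. $\mathbb P(R)$ is the set of subsets of $R$ whose induced subgraph is isomorphic to $R$. A labeling of $L\in\mathbb P(R)$ is a partition $\{L_n:n\in\omega\}$ of $L$ together with a bijection $(n,K)\mapsto q^{\bigcup_{i<n}L_i}_K$ from $\bigcup_n\{n\}\times P(\bigcup_{i<n}L_i)$ onto $L$ with $L_n=\{q^{\bigcup_{i<n}L_i}_K:K\subset\bigcup_{i<n}L_i\}$ and $q^{\bigcup_{i<n}L_i}_K\in L^{\bigcup_{i<n}L_i}_K$. The integers $m_n$ are $m_0=1$, $m_n=2^{\sum_{i<n}m_i}$. Intervals $(p,q]$ and $(-\infty,q]$ are taken in $\langle L,\le_L\rangle$. A reversed tree is a poset whose reverse is a tree; its $n$-th level consists of elements having exactly $n$ elements strictly above them; $p$ is an immediate predecessor of $q$ iff $p<_L q$ and there is nothing strictly between them. *)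

(* Defs.v *)
From mathcomp Require Import all_boot.
From mathcomp Require Import mathcomp_extra boolp classical_sets functions.
From mathcomp Require Import cardinality.

Set Implicit Arguments.
Unset Strict Implicit.
Unset Printing Implicit Defensive.

Local Open Scope classical_set_scope.
Local Open Scope card_scope.

(* A poset is a carrier [A : set T] with a relation [le] on [T]; only the
   restriction of [le] to [A] matters. *)
Section Posets.
Variables (T : Type) (A : set T) (le : T -> T -> Prop).

Definition poset_on :=
  [/\ forall x, A x -> le x x,
      forall x y, A x -> A y -> le x y -> le y x -> x = y
    & forall x y z, A x -> A y -> A z -> le x y -> le y z -> le x z].

Definition slt (x y : T) := le x y /\ x <> y.

Definition well_ordered_on :=
  [/\ poset_on, total_on A le
    & forall B : set T, B `<=` A -> B !=set0 ->
        exists2 x, B x & forall y, B y -> le x y].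

Definition is_top (t : T) := A t /\ forall x, A x -> le x t.

Definition interval_oc (p q : T) : set T := [set x | [/\ A x, slt p x & le x q]].

Definition down_set (q : T) : set T := [set x | A x /\ le x q].

Definition strictly_above (x : T) : set T := [set y | A y /\ slt x y].

Definition imm_pred (q : T) : set T :=
  [set p | [/\ A p, slt p q & ~ exists r, [/\ A r, slt p r & slt r q]]].

Definition minimal (x : T) := A x /\ ~ exists y, A y /\ slt y x.

(* Levels of a reversed tree: the nodes with exactly [n] nodes above them. *)
Definition rev_level (n : nat) : set T :=
  [set x | A x /\ strictly_above x #= `I_n].

Definition finitely_branching := forall q, A q -> finite_set (imm_pred q).

End Posets.

Definition is_tree (T : Type) (A : set T) (le : T -> T -> Prop) :=
  poset_on A le /\
  forall t, A t -> well_ordered_on [set s | A s /\ slt le s t] le.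

Definition is_reversed_tree (T : Type) (A : set T) (le : T -> T -> Prop) :=
  is_tree A (fun x y => le y x).

Section Rado.
Variables (V : Type) (adj : V -> V -> Prop).

(* [ext L H K] is L^H_K; [ext setT H K] is R^H_K. *)
Definition ext (L H K : set V) : set V :=
  [set v | [/\ L v, ~ H v, forall k, K k -> adj v k
             & forall h, (H `\` K) h -> ~ adj v h]].

Definition is_rado_graph :=
  [/\ forall x, ~ adj x x,
      forall x y, adj x y -> adj y x,
      countable [set: V]
    & forall H K : set V, finite_set H -> K `<=` H -> ext setT H K !=set0].

(* Membership in P(R). *)
Definition is_copy (L : set V) :=
  exists2 f : V -> V, set_bij setT L f & forall x y, adj (f x) (f y) <-> adj x y.

Definition below (Ln : nat -> set V) (n : nat) : set V :=
  \bigcup_(i in `I_n) Ln i.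

(* [q n K] stands for q^{below Ln n}_K; only the values at
   [K `<=` below Ln n] are meaningful. *)
Definition is_labeling (L : set V) (Ln : nat -> set V)
    (q : nat -> set V -> V) :=
  [/\ partition [set: nat] Ln L,
      set_bij [set p : nat * set V | p.2 `<=` below Ln p.1] L
        (fun p => q p.1 p.2),
      forall n, Ln n = [set q n K | K in [set K | K `<=` below Ln n]]
    & forall n K, K `<=` below Ln n -> ext L (below Ln n) K (q n K)].

Definition label_le (L : set V) (Ln : nat -> set V) (q : nat -> set V -> V)
    (x y : V) :=
  exists m K' n K'',
    [/\ K' `<=` below Ln m, x = q m K', K'' `<=` below Ln n, y = q n K''
      & ext L (below Ln m) K' `<=` ext L (below Ln n) K''].

Lemma label_leP (L : set V) (Ln : nat -> set V) (q : nat -> set V -> V)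
    (m n : nat) (K' K'' : set V) :
  is_labeling L Ln q -> K' `<=` below Ln m -> K'' `<=` below Ln n ->
  label_le L Ln q (q m K') (q n K'') <->
  ext L (below Ln m) K' `<=` ext L (below Ln n) K''.
Proof.
move=> [_ [_ qinj _] _ _] sK' sK''; split; last first.
  by move=> sub; exists m, K', n, K''.
have inj (i j : nat) (A B : set V) : A `<=` below Ln i -> B `<=` below Ln j ->
    q i A = q j B -> i = j /\ A = B.
  move=> sA sB e.
  have [-> ->] : (i, A) = (j, B) by apply: qinj => //; rewrite inE.
  by [].
move=> [i [A [j [B [sA eA sB eB]]]]].
by have [-> ->] := inj _ _ _ _ sK' sA eA; have [-> ->] := inj _ _ _ _ sK'' sB eB.
Qed.

End Rado.

(* m_n = 2 ^ (m_0 + ... + m_(n-1)), computed through its partial sums. *)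
Fixpoint level_sum (n : nat) : nat :=
  if n is n'.+1 then level_sum n' + 2 ^ level_sum n' else 0.

Definition level_size (n : nat) : nat := 2 ^ level_sum n.

Lemma level_size0 : level_size 0 = 1.
Proof. by []. Qed.

Lemma level_sizeE (n : nat) : level_size n = 2 ^ \sum_(i < n) level_size i.
Proof.
rewrite /level_size; congr (2 ^ _).
by elim: n => [|n IHn]; rewrite ?big_ord0 // big_ord_recr /= -IHn.
Qed.

(* Main.v *)
(** For [K' `<=` H m] and [K `<=` H n], the point [q m K'] lies in [L^{H n}_K]
    iff [n <= m] and [K = K' `&` H n]: a point of level [m] avoids [H n] iff
    [n <= m], and its neighbours in [H m] are exactly the elements of [K'].
    The inclusion [L^{H m}_{K'} `<=` L^{H n}_K] amounts to the same condition,
    because it is tested on [q m K']. Hence [leL] is reverse end-extension of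
    labels [(m, K')], and all claims are read off from that order; the level
    sizes come from counting the subsets of [H n]. *)
Require Import Defs.
From mathcomp Require Import all_boot.
From mathcomp Require Import mathcomp_extra boolp classical_sets functions.
From mathcomp Require Import cardinality.

Local Open Scope classical_set_scope.
Local Open Scope card_scope.

Set Implicit Arguments.
Unset Strict Implicit.

(** * Finite cardinalities of disjoint unions and power sets *)

Lemma card_setU_II (T : Type) (A B : set T) (m n : nat) :
  A `&` B = set0 -> A #= `I_m -> B #= `I_n -> A `|` B #= `I_(m + n).
Proof.
elim: m A => [|m IHm] A AB0 cA cB.
  by move: cA; rewrite II0 card_eq0 => /eqP ->; rewrite set0U.
have /eq_cardSP[x Ax cAx] := cA.
rewrite addSn; apply/eq_cardSP; exists x; first by left.
have nBx : ~ B x by move=> Bx; have : (A `&` B) x by []; rewrite AB0.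
have -> : (A `|` B) `\ x = (A `\ x) `|` B.
  rewrite setDUl; congr (_ `|` _); apply/seteqP; split=> y; first by case.
  by move=> By; split=> // yx; apply: nBx; rewrite -yx.
apply: IHm => //; apply/seteqP; split=> // y [[Ay _] By].
by rewrite -AB0.
Qed.

(** Fix [x] in [A]: the subsets of [A] avoiding [x] and those containing it form two disjoint
    families, matched by adding [x], so each further point doubles the count. *)
Lemma card_powerset_II (T : Type) (A : set T) (n : nat) :
  A #= `I_n -> [set B | B `<=` A] #= `I_(2 ^ n).
Proof.
elim: n A => [|n IHn] A cA.
  move: cA; rewrite II0 card_eq0 => /eqP ->.
  have -> : [set B : set T | B `<=` set0] = [set set0].
    by apply/seteqP; split=> B /=; rewrite subset0.
  exact: card_set1.
have /eq_cardSP[x Ax cAx] := cA.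
have -> : [set B | B `<=` A] =
    [set B | B `<=` A `\ x] `|` setU [set x] @` [set B | B `<=` A `\ x].
  apply/seteqP; split=> [B /= BA|B /= [BA y /BA[]//|[C CA <-] y [->//|/CA[]//]]].
  have [Bx|nBx] := pselect (B x).
    right; exists (B `\ x); first by move=> y [/BA].
    exact: setD1K.
  by left=> y By; split; [exact: BA|move=> yx; apply: nBx; rewrite -yx].
rewrite expnS mul2n -addnn; apply: card_setU_II; last 2 first.
- exact: IHn.
- apply: card_eq_trans (IHn _ cAx); apply: inj_card_eq => B C.
  rewrite !inE /= => BA CA eBC.
  (* Removing [x] undoes adding it, which makes the matching injective. *)
  have U1K (D : set T) : D `<=` A `\ x -> (x |` D) `\ x = D.
    move=> DA; apply/seteqP; split=> [y [[]//]|y Dy]; split; first by right.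
    by case: (DA _ Dy).
  by rewrite -(U1K B) // eBC U1K.
- apply/seteqP; split=> // B [/= BA [C _ eB]].
  have /BA[_] : B x by rewrite -eB; left.
  by apply.
Qed.

(** * Levels and labels *)

Section Labeling.
Variables (V : Type) (adj : V -> V -> Prop) (L : set V).
Variables (Ln : nat -> set V) (q : nat -> set V -> V).
Hypothesis hq : is_labeling adj L Ln q.

Local Notation H := (below Ln).
Local Notation leL := (label_le adj L Ln q).

Lemma below_le m n : (m <= n)%N -> H m `<=` H n.
Proof. by move=> mn x [i /= im Lx]; exists i => //=; exact: leq_trans im mn. Qed.

Lemma below0 : H 0 = set0.
Proof. by apply/seteqP; split=> // x []. Qed.

Lemma belowS n : H n.+1 = H n `|` Ln n.
Proof.
apply/seteqP; split=> [x [i /=]|x [[i /= im Lx]|Lx]].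
- by rewrite ltnS leq_eqVlt => /predU1P[-> Lx|im Lx]; [right|left; exists i].
- by exists i => //=; exact: ltnW.
- by exists n => /=.
Qed.

Lemma level_trivIset : trivIset [set: nat] Ln.
Proof. by case: hq => -[]. Qed.

Lemma below_level0 n : H n `&` Ln n = set0.
Proof.
apply/seteqP; split=> // x [[i /= ilt Lx] Lnx].
have e : i = n by apply: level_trivIset => //; exists x.
by rewrite e ltnn in ilt.
Qed.

Lemma label_level n K : K `<=` H n -> Ln n (q n K).
Proof. by move=> sK; case: hq => _ _ -> _; exists K. Qed.

Lemma label_in n K : K `<=` H n -> L (q n K).
Proof. by move=> sK; case: hq => _ _ _ /(_ _ _ sK)[]. Qed.

Lemma label_inj m n K' K : K' `<=` H m -> K `<=` H n ->
  q m K' = q n K -> m = n /\ K' = K.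
Proof.
case: hq => _ [_ qinj _] _ _ sK' sK e.
have [-> ->] // : (m, K') = (n, K) by apply: qinj => //; rewrite inE.
Qed.

Lemma label_surj x : L x -> exists m K, K `<=` H m /\ x = q m K.
Proof. by case: hq => _ [_ _ qs] _ _ /qs[[m K] /= sK <-]; exists m, K. Qed.

(** * The order in terms of labels *)

Lemma ext_labelP m n K' K : K' `<=` H m -> K `<=` H n ->
  ext adj L (H n) K (q m K') <-> (n <= m)%N /\ K = K' `&` H n.
Proof.
move=> sK' sK; have [_ _ _ /(_ _ _ sK')[Lq nHq adjq nadjq]] := hq.
split=> [[_ nHnq adjn nadjn]|[nm ->]].
  have nm : (n <= m)%N.
    rewrite leqNgt; apply/negP => mn; apply: nHnq; exists m => //.
    exact: label_level.
  split=> //; apply/seteqP; split=> [k Kk|k [K'k Hk]].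
    split; last exact: sK.
    apply: contrapT => nK'k; apply: (nadjq k) (adjn k Kk).
    by split=> //; apply: (below_le nm); exact: sK.
  by apply: contrapT => nKk; apply: (nadjn k) (adjq k K'k).
split=> // [/(below_le nm)//|k [/adjq//]|h [Hh nKh]].
apply: nadjq; split; first exact: (below_le nm).
by move=> K'h; apply: nKh.
Qed.

Lemma label_leE m n K' K : K' `<=` H m -> K `<=` H n ->
  leL (q m K') (q n K) <-> (n <= m)%N /\ K = K' `&` H n.
Proof.
move=> sK' sK; split.
  move/(label_leP hq sK' sK) => sub; apply/(ext_labelP sK' sK)/sub.
  by case: hq => _ _ _; apply.
(* Conversely, a point whose neighbours in [H m] are exactly [K'] has exactly [K']&[H n] as
   neighbours in the smaller set [H n]. *)
move=> [nm eK]; apply/(label_leP hq sK' sK) => v [Lv nHv adjv nadjv].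
split=> // [/(below_le nm)//|k|h [Hh nKh]]; first by rewrite eK => -[/adjv].
apply: nadjv; split; first exact: (below_le nm).
by move=> K'h; apply: nKh; rewrite eK.
Qed.

Lemma label_ltE m n K' K : K' `<=` H m -> K `<=` H n ->
  slt leL (q m K') (q n K) <-> (n < m)%N /\ K = K' `&` H n.
Proof.
move=> sK' sK; split=> [[/(label_leE sK' sK)[nm eK] neq]|[nm eK]].
  split=> //; rewrite ltn_neqAle nm andbT; apply/eqP => enm.
  by subst n; apply: neq; rewrite eK (setIidl sK').
split; first by apply/(label_leE sK' sK); split=> //; exact: ltnW.
by move=> /(label_inj sK' sK)[emn _]; rewrite emn ltnn in nm.
Qed.

(** A larger label is a truncation of [K], hence determined by its level alone. Intervals, chains
    and levels all rest on this description. *)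
Lemma strictly_above_label n K : K `<=` H n ->
  strictly_above L leL (q n K) = [set q m (K `&` H m) | m in `I_n].
Proof.
move=> sK; apply/seteqP; split=> x /=.
  move=> [Lx]; have [m [K' [sK' ->]]] := label_surj Lx.
  by move=> /(label_ltE sK sK')[mn ->]; exists m.
move=> [m mn <-]; split; first by apply: label_in.
by apply/label_ltE.
Qed.

(** * The reversed tree and its levels *)

Lemma label_poset : poset_on L leL.
Proof.
split=> [x Lx|x y Lx Ly|x y z Lx Ly Lz].
- have [m [K [sK ->]]] := label_surj Lx.
  by apply/label_leE => //; rewrite (setIidl sK).
- have [m [K [sK ->]]] := label_surj Lx.
  have [n [K' [sK' ->]]] := label_surj Ly.
  move=> /label_leE-/(_ sK sK')[nm eK'] /label_leE-/(_ sK' sK)[mn eK].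
  have enm : n = m by apply/eqP; rewrite eqn_leq nm.
  by subst n; rewrite eK' (setIidl sK).
- have [m [K [sK ->]]] := label_surj Lx.
  have [n [K' [sK' ->]]] := label_surj Ly.
  have [p [K'' [sK'' ->]]] := label_surj Lz.
  move=> /label_leE-/(_ sK sK')[nm eK'] /label_leE-/(_ sK' sK'')[pn eK''].
  apply/label_leE => //; split; first exact: leq_trans nm.
  by rewrite eK'' eK' -setIA (setIidr (below_le pn)).
Qed.

Lemma label_reversed_tree : is_reversed_tree L leL.
Proof.
have [refl anti trans] := label_poset.
split; first split=> [//|x y Lx Ly xy yx|x y z Lx Ly Lz xy yz].
- exact: anti.
- exact: (trans z y x).
move=> t Lt; have [n [K [sK et]]] := label_surj Lt.
have -> : [set s | L s /\ slt (fun x y => leL y x) s t] =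
    [set q m (K `&` H m) | m in `I_n].
  rewrite -strictly_above_label // -et; apply/seteqP.
  by split=> x [Lx [xt ne]]; split=> //; split=> // /esym.
have sKH m : K `&` H m `<=` H m by move=> x [].
have chainL x : [set q m (K `&` H m) | m in `I_n] x -> L x.
  by move=> [m _ <-]; exact: label_in.
(* Smaller levels sit higher in [leL], so in the reversed order the chain is indexed increasingly
   and inherits totality and well-ordering from the naturals. *)
have chain_le i j : (i <= j)%N -> leL (q j (K `&` H j)) (q i (K `&` H i)).
  move=> ij; apply/label_leE => //; split=> //.
  by rewrite -setIA (setIidr (below_le ij)).
split.
- split=> [x /chainL|x y /chainL Lx /chainL Ly xy yx|].
  + exact: refl.
  + exact: anti.
  + move=> x y z /chainL Lx /chainL Ly /chainL Lz xy yz.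
    exact: (trans z y x).
- move=> x y [i _ <-] [j _ <-].
  by case: (leqP i j) => [|/ltnW] ij; [left|right]; exact: chain_le.
- move=> B sB [x Bx].
  have exB : exists m, `[< B (q m (K `&` H m)) >].
    by have [m _ em] := sB _ Bx; exists m; apply/asboolP; rewrite em.
  (* The reversed-order least element of [B] is the one of smallest level. *)
  case: (ex_minnP exB) => m /asboolP Bm minm; exists (q m (K `&` H m)) => //.
  move=> y By; have [j _ ej] := sB _ By; rewrite -ej; apply/chain_le/minm.
  by apply/asboolP; rewrite ej.
Qed.

Lemma label_top : is_top L leL (q 0 set0).
Proof.
split; first exact: label_in.
move=> x Lx; have [m [K [sK ->]]] := label_surj Lx.
by apply/label_leE => //; rewrite below0 setI0.
Qed.

(** The upper bound is the top, so it imposes no condition. *)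
Lemma interval_label n K : K `<=` H n ->
  interval_oc L leL (q n K) (q 0 set0) = [set q m (K `&` H m) | m in `I_n].
Proof.
move=> sK; rewrite -strictly_above_label //; apply/seteqP.
by split=> x [Lx ltx]; split=> //; apply: label_top.2.
Qed.

Lemma card_strictly_above n K : K `<=` H n ->
  strictly_above L leL (q n K) #= `I_n.
Proof.
move=> sK; rewrite strictly_above_label //; apply: inj_card_eq => i j _ _.
by move=> /label_inj-[||//] x [].
Qed.

(** A point labelled at level [m] has exactly [m] points strictly above it, so that count recovers
    its level. *)
Lemma level_rev_level n : Ln n = rev_level L leL n.
Proof.
apply/seteqP; split=> [x|x [Lx]].
  have [_ _ -> _] := hq; move=> [K /= sK <-].
  by split; [exact: label_in|exact: card_strictly_above].
have [m [K [sK ->]]] := label_surj Lx.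
rewrite (card_eql (card_strictly_above sK)) => /card_eq_II <-.
exact: label_level.
Qed.

(** Both memberships reduce to the same condition on labels, by [label_leE] and [ext_labelP]. *)
Lemma down_set_label n K : K `<=` H n ->
  down_set L leL (q n K) = ext adj L (H n) K.
Proof.
move=> sK; apply/seteqP; split=> x.
  move=> [Lx]; have [m [K' [sK' ->]]] := label_surj Lx.
  by move=> /label_leE-/(_ sK' sK) /(ext_labelP sK' sK).
move=> ex; have Lx : L x by case: ex.
split=> //; have [m [K' [sK' xE]]] := label_surj Lx.
by rewrite xE; apply/label_leE => //; apply/ext_labelP => //; rewrite -xE.
Qed.

(** * Immediate predecessors *)

Lemma below_setU n K K1 : K `<=` H n -> K1 `<=` Ln n -> K `|` K1 `<=` H n.+1.
Proof. by move=> sK sK1; rewrite belowS; exact: setUSS. Qed.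

Lemma setU_below n K K1 : K `<=` H n -> K1 `<=` Ln n -> (K `|` K1) `&` H n = K.
Proof.
move=> sK sK1; rewrite setIUl (setIidl sK).
suff -> : K1 `&` H n = set0 by rewrite setU0.
by apply/seteqP; split=> // x [/sK1 Lx Hx]; rewrite -(below_level0 n).
Qed.

Lemma setU_level n K K1 : K `<=` H n -> K1 `<=` Ln n -> (K `|` K1) `&` Ln n = K1.
Proof.
move=> sK sK1; rewrite setIUl (setIidl sK1).
suff -> : K `&` Ln n = set0 by rewrite set0U.
by apply/seteqP; split=> // x [/sK Hx Lx]; rewrite -(below_level0 n).
Qed.

Lemma imm_pred_label n K : K `<=` H n ->
  imm_pred L leL (q n K) =
    [set q n.+1 (K `|` K1) | K1 in [set K1 | K1 `<=` Ln n]].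
Proof.
move=> sK; apply/seteqP; split=> x /=.
  move=> [Lx]; have [m [K' [sK' ->]]] := label_surj Lx.
  move=> /(label_ltE sK' sK)[nm eK] nbetween.
  (* If [m] exceeded [n.+1], truncating [K'] to [H n.+1] would give a point strictly in between. *)
  have em : m = n.+1.
    apply/eqP; rewrite eq_sym eqn_leq nm leqNgt; apply/negP => nm1.
    have sKr : K' `&` H n.+1 `<=` H n.+1 by move=> y [].
    apply: nbetween; exists (q n.+1 (K' `&` H n.+1)); split.
    - exact: label_in.
    - exact/label_ltE.
    - apply/label_ltE => //; split=> //.
      by rewrite eK -setIA (setIidr (below_le (leqnSn n))).
  (* [K'] splits into its trace on [H n], which is [K], and its trace on [Ln n]. *)
  subst m; exists (K' `&` Ln n); first by move=> y [].
  by rewrite eK -setIUr -belowS (setIidl sK').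
move=> [K1 sK1 <-]; have sKK1 := below_setU sK sK1; split.
- exact: label_in.
- by apply/label_ltE => //; rewrite setU_below.
(* An intermediate point would have a level strictly between [n] and [n.+1]. *)
move=> [r [Lr]]; have [m [K' [sK' ->]]] := label_surj Lr.
move=> /label_ltE-/(_ sKK1 sK')[mn _] /label_ltE-/(_ sK' sK)[nm _].
by move: mn; rewrite ltnS leqNgt nm.
Qed.

(** The same set [K], used as a label at the next level, gives a point strictly below. *)
Lemma label_no_minimal : ~ exists x, minimal L leL x.
Proof.
move=> [x [Lx nlt]]; have [m [K [sK ex]]] := label_surj Lx.
have sKS : K `<=` H m.+1 by move=> y /sK; exact: below_le.
apply: nlt; exists (q m.+1 K); split; first exact: label_in.
by rewrite ex; apply/label_ltE => //; rewrite (setIidl sK).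
Qed.

(** * Level sizes and branching numbers *)

Lemma card_level_of_below n k : H n #= `I_k -> Ln n #= `I_(2 ^ k).
Proof.
move=> cH; apply: card_eq_trans (card_powerset_II cH).
(* [Ln n] is the injective image under [q n] of the power set of [H n]. *)
have [_ _ -> _] := hq; apply: inj_card_eq => K K'.
by rewrite !inE /= => sK sK' /label_inj-/(_ sK sK')[].
Qed.

Lemma card_below n : H n #= `I_(level_sum n).
Proof.
elim: n => [|n IHn]; first by rewrite below0 II0.
rewrite belowS; apply: card_setU_II => //; first exact: below_level0.
exact: card_level_of_below.
Qed.

Lemma card_level n : Ln n #= `I_(level_size n).
Proof. exact: card_level_of_below (card_below n). Qed.

(** Predecessors correspond to subsets of [Ln n]: the added part [K1] is recovered from the label as
    its trace on [Ln n]. *)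
Lemma card_imm_pred n x : Ln n x -> imm_pred L leL x #= `I_(2 ^ level_size n).
Proof.
have [_ _ -> _] := hq; move=> [K /= sK <-].
apply: card_eq_trans (card_powerset_II (card_level n)).
rewrite imm_pred_label //; apply: inj_card_eq => K1 K2.
rewrite !inE /= => sK1 sK2 /label_inj[||_ eK]; try exact: below_setU.
by rewrite -(setU_level sK sK1) eK setU_level.
Qed.

Lemma label_finitely_branching : finitely_branching L leL.
Proof.
move=> x Lx; have [m [K [sK ->]]] := label_surj Lx.
by exists (2 ^ level_size m)%N; apply: card_imm_pred; exact: label_level.
Qed.

End Labeling.

Theorem theorem8p1 (V : Type) (adj : V -> V -> Prop) (L : set V)
    (Ln : nat -> set V) (q : nat -> set V -> V)
    (hR : is_rado_graph adj) (hL : is_copy adj L)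
    (hq : is_labeling adj L Ln q) :
  let H := below Ln in
  let leL := label_le adj L Ln q in
  forall (n : nat) (K : set V), K `<=` H n ->
  [/\ (* (a) *)
      interval_oc L leL (q n K) (q 0 set0) =
        [set q m (K `&` H m) | m in [set m : nat | (m < n)%N]],
      (* (b) *)
      [/\ is_reversed_tree L leL, is_top L leL (q 0 set0)
        & Ln n = rev_level L leL n],
      (* (c) *)
      down_set L leL (q n K) = ext adj L (H n) K,
      (* (d) *)
      imm_pred L leL (q n K) =
        [set q n.+1 (K `|` K1) | K1 in [set K1 | K1 `<=` Ln n]]
    & (* (e) *)
      [/\ is_reversed_tree L leL, finitely_branching L leL,
          ~ (exists x, minimal L leL x)
        & exists k : nat,
            [/\ Ln n #= `I_k, (2 ^ k = 2 ^ level_size n)%N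
              & forall x, Ln n x -> imm_pred L leL x #= `I_(2 ^ k)]]].
Proof.
move=> H leL n K sK; split.
- exact: interval_label.
- split; [exact: label_reversed_tree|exact: label_top|exact: level_rev_level].
- exact: down_set_label.
- exact: imm_pred_label.
- split; [exact: label_reversed_tree|exact: label_finitely_branching
         |exact: label_no_minimal|].
  exists (level_size n); split=> //; first exact: (card_level hq).
  by move=> x; exact: card_imm_pred.
Qed.
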